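(* Let $n$ be a positive integer. (i) The complete graph $K_n$ is power-critical if and only if $n$ is a prime power. (ii) If $n$ is a prime power, then any graph of order $n$ (that is, with $n$ vertices) is power-critical.
   Context: Graphs are finite, simple and undirected. The power graph $\Gamma_G$ of a group $G$ has vertex set $G$, and two distinct elements are adjacent if one is a power of the other. An embedding of a graph $\Gamma_1$ into a graph $\Gamma_2$ is an injection $f:V(\Gamma_1)\to V(\Gamma_2)$ such that $\{x,y\}\in E(\Gamma_1)$ implies $\{f(x),f(y)\}\in E(\Gamma_2)$ (the image need not be an induced subgraph). The power index $\Theta(\Gamma)$ of a graph $\Gamma$ is the least order of a group $G$ such that $\Gamma$ embeds into $\Gamma_G$. A graph $\Gamma$ is power-critical if $|V(\Gamma)|=\Theta(\Gamma)$. A prime power is an integer $p^m$ with $p$ prime and $m\ge 0$; in particular $1$ counts as a prime power. *)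

(* Defs.v *)
From HB Require Import structures.
From mathcomp Require Import all_boot all_fingroup.

Set Implicit Arguments.
Unset Strict Implicit.
Unset Printing Implicit Defensive.

Record sgraph := SGraph {
  vertex :> finType;
  adj : rel vertex;
  adj_sym : symmetric adj;
  adj_irrefl : irreflexive adj
}.

Definition complete_adj (n : nat) : rel 'I_n := fun x y => x != y.

Lemma complete_adj_sym (n : nat) : symmetric (@complete_adj n).
Proof. by move=> x y; rewrite /complete_adj eq_sym. Qed.

Lemma complete_adj_irrefl (n : nat) : irreflexive (@complete_adj n).
Proof. by move=> x; rewrite /complete_adj eqxx. Qed.

Definition complete_graph (n : nat) : sgraph :=
  SGraph (@complete_adj_sym n) (@complete_adj_irrefl n).

(* In a finite group the cyclic subgroup <[y]> is exactly the set of powers of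
   y, so [power_adj x y] says that x and y are distinct and that one is a power
   of the other; see [power_adjP]. *)
Definition power_adj (gT : finGroupType) : rel gT :=
  fun x y => (x != y) && ((x \in <[y]>%g) || (y \in <[x]>%g)).

Lemma power_adjP (gT : finGroupType) (x y : gT) :
  reflect (x <> y /\ ((exists i : nat, x = (y ^+ i)%g) \/
                      (exists i : nat, y = (x ^+ i)%g)))
          (power_adj x y).
Proof.
apply: (iffP andP) => [[/eqP nxy /orP[] /cycleP pxy]|[/eqP nxy pxy]].
- by split; [|left].
- by split; [|right].
by split=> //; apply/orP; case: pxy => /cycleP; [left|right].
Qed.

Lemma power_adj_sym (gT : finGroupType) : symmetric (@power_adj gT).
Proof. by move=> x y; rewrite /power_adj eq_sym orbC. Qed.

Lemma power_adj_irrefl (gT : finGroupType) : irreflexive (@power_adj gT).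
Proof. by move=> x; rewrite /power_adj eqxx. Qed.

Definition power_graph (gT : finGroupType) : sgraph :=
  SGraph (@power_adj_sym gT) (@power_adj_irrefl gT).

Definition embedding (G H : sgraph) (f : G -> H) : Prop :=
  injective f /\ forall x y : G, adj x y -> adj (f x) (f y).

Definition embeds (G H : sgraph) : Prop := exists f : G -> H, embedding f.

(* The power index as a relation: [is_power_index G k] says that k is the least
   element of the set of orders of groups whose power graph contains G. Such a
   k is unique, and infinite groups cannot realise it, since every finite graph
   embeds into the power graph of a large cyclic group of prime power order. *)
Definition is_power_index (G : sgraph) (k : nat) : Prop :=
  (exists gT : finGroupType, #|gT| = k /\ embeds G (power_graph gT)) /\
  (forall gT : finGroupType, embeds G (power_graph gT) -> k <= #|gT|).

Definition power_critical (G : sgraph) : Prop := is_power_index G #|G|.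

(* The exponent may be 0, so 1 is a prime power. *)
Definition prime_power (n : nat) : Prop :=
  exists p m : nat, prime p /\ n = p ^ m.

(* Main.v *)
Require Import Defs.
From mathcomp Require Import all_boot all_fingroup.
From mathcomp Require Import zmodp cyclic pgroup.

(** A cyclic group of prime power order has a subgroup lattice that is a chain,
so its power graph is complete. Conversely, if two distinct primes p and q
divide the order of a group, then by Cauchy's theorem it has elements of order
p and q, and neither is a power of the other. *)

Lemma embeds_leq_card (G H : sgraph) : embeds G H -> #|G| <= #|H|.
Proof. by case=> f [f_inj _]; exact: (leq_card f f_inj). Qed.

Lemma power_adj_cyclic_pgroup (gT : finGroupType) (p : nat) (x y : gT) :
  cyclic [set: gT] -> (p.-group [set: gT])%g -> x != y -> power_adj x y.
Proof.
move=> cycG pG neq_xy; rewrite /power_adj neq_xy -!cycle_subG.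
(* In a cyclic group, inclusion of subgroups is divisibility of their orders; here all orders are
   powers of [p], hence comparable. *)
have sub_dvd (u v : gT) : (<[u]> \subset <[v]>)%g = (#[u]%g %| #[v]%g).
  by rewrite -(cardSg_cyclic cycG) ?subsetT.
rewrite !sub_dvd.
have [a ->] := p_natP (mem_p_elt pG (in_setT x)).
have [b ->] := p_natP (mem_p_elt pG (in_setT y)).
by case/orP: (leq_total a b) => le_ab; rewrite (dvdn_exp2l p le_ab) ?orbT.
Qed.

(** The lower bound is injectivity alone. It is attained by the cyclic group of order [#|G|]: its
    power graph is complete, so any injection into it preserves adjacency. *)
Lemma power_critical_prime_power (G : sgraph) :
  prime_power #|G| -> power_critical G.
Proof.
case=> p [m [p_pr cardG]]; split=> [|gT]; last exact: embeds_leq_card.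
(* The additive group of integers modulo a positive number lives on ['I_k.+1], so the order must be
   a successor. *)
have [k def_k] : exists k, p ^ m = k.+1.
  by exists (p ^ m).-1; rewrite prednK // expn_gt0 prime_gt0.
have cardK : #|'I_k.+1| = #|G| by rewrite card_ord cardG.
exists 'I_k.+1; split=> //.
(* The cardinals are equal; the inequality lets [widen_ord] transport the rank of a vertex to the
   group. *)
have le_card : #|G| <= #|'I_k.+1| by rewrite cardK.
have inj_emb :
    injective (fun x : G => enum_val (widen_ord le_card (enum_rank x))).
  move=> x y /enum_val_inj eq_xy; apply: enum_rank_inj; apply: val_inj.
  by have /(congr1 val) := eq_xy.
exists (fun x => enum_val (widen_ord le_card (enum_rank x))); split=> // x y adj_xy.
apply: (@power_adj_cyclic_pgroup _ p).
- by apply/cyclicP; exists Zp1; exact: Zp_cycle.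
- by rewrite /pgroup cardsT cardK cardG pnatX pnat_id.
by rewrite (inj_eq inj_emb); apply: contraTneq adj_xy => ->; rewrite adj_irrefl.
Qed.

Lemma prime_power_of_complete_power_graph (gT : finGroupType) :
  (forall x y : gT, x != y -> power_adj x y) -> prime_power #|gT|.
Proof.
move=> complete; case: (leqP #|gT| 1) => [le1|gt1].
  exists 2, 0; split=> //; apply/eqP; rewrite expn0 eqn_leq le1.
  by apply/card_gt0P; exists 1%g.
have p_pr := pdiv_prime gt1; set p := pdiv _ in p_pr.
suff /p_natP [m ->] : p.-nat #|gT| by exists p, m.
apply/pnatP=> [|q q_pr q_dvd]; first exact: ltnW.
have [x _ ox] : {x | x \in [set: gT] & #[x]%g = p}.
  by apply: Cauchy; rewrite ?cardsT ?pdiv_dvd.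
have [y _ oy] : {y | y \in [set: gT] & #[y]%g = q}.
  by apply: Cauchy; rewrite ?cardsT.
(* If [x] and [y] coincide, then [p] and [q] are the same order; otherwise adjacency makes one prime
   divide the other. *)
have [eq_xy|neq_xy] := eqVneq x y; first by rewrite inE -oy -eq_xy ox.
have /andP[_ /orP[] /order_dvdG] := complete x y neq_xy;
  rewrite -!/(#[_])%g ox oy dvdn_prime2 // => /eqP eq_pq; by rewrite inE eq_pq.
Qed.

Theorem mainTheorem6 (n : nat) (n_gt0 : 0 < n) :
  (power_critical (complete_graph n) <-> prime_power n) /\
  (prime_power n -> forall G : sgraph, #|G| = n -> power_critical G).
Proof.
have critical G : #|vertex G| = n -> prime_power n -> power_critical G.
  by move=> <-; exact: power_critical_prime_power.
split; last by move=> ppn G cardG; exact: critical.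
have cardK : #|complete_graph n| = n by rewrite card_ord.
split; last exact: critical.
case=> -[gT [cardgT [f [f_inj f_adj]]]] _; rewrite -cardK -cardgT.
(* The group has exactly as many elements as the graph has vertices, so any two distinct elements
   are images of adjacent vertices. *)
have [g _ gK] : bijective f by apply: (inj_card_bij f_inj); rewrite cardgT.
apply: prime_power_of_complete_power_graph => x y neq_xy.
rewrite -(gK x) -(gK y); apply: f_adj.
by apply: contraNneq neq_xy => eq_g; rewrite -(gK x) eq_g gK.
Qed.
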